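(* Fix an integer $d\ge 2$. For each $n$ let $\mathbf p=\mathbf p(n)=(p_1,\dots,p_d)\in(0,1]^d$. (i) Suppose $\min_{i=1,\dots,d-1}\liminf_{n\to\infty}p_i>0$, $np_d(1-p_d)\to\infty$ and $p_d=o(1)$. Then for the multi-parameter random simplicial complex $Y=Y_d(n,\mathbf p)$, $$\frac{N_{d-1}(Y)}{|Y^{d-1}|}\to 0\quad\text{in probability as } n\to\infty.$$ (ii) Suppose $np_d(1-p_d)\to\infty$. Then for the multi-parameter upper model $Z=Z_d(n,\mathbf p)$, $$\frac{N_{d-1}(Z)}{|Z^{d-1}|}\to 0\quad\text{almost surely as } n\to\infty.$$
   Context: Simplicial complexes: a simplicial complex $X$ on a finite vertex set is a collection of subsets closed under taking subsets. A cell $\sigma\in X$ has dimension $|\sigma|-1$; a cell of dimension $j$ is a $j$-cell, and $X^j$ is the set of $j$-cells of $X$. A $(d-1)$-cell of $X$ is called maximal if it is not contained in any $d$-cell of $X$; $N_{d-1}(X)$ is the number of maximal $(d-1)$-cells of $X$. (Ratios with denominator $0$ are taken to be $0$.) Random hypergraph: let $\chi_\tau^{(n)}$, for $\tau\subseteq[n]=\{1,\dots,n\}$ with $2\le|\tau|\le d+1$, be independent Bernoulli random variables with parameter $p_{|\tau|-1}(n)$ (a triangular family of independent random variables over all $n$, on one probability space), and let $\mathcal X(n,\mathbf p)=\{\tau:\chi^{(n)}_\tau=1\}$. Lower model: $Y_d(n,\mathbf p)$ is the set of all $\sigma\subseteq[n]$ with $|\sigma|\le d+1$ such that $\tau\in\mathcal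 X(n,\mathbf p)$ for every $\tau\subseteq\sigma$ with $|\tau|\ge2$. (Equivalently, starting from $n$ vertices, for $k=1,\dots,d$ in turn, every $k$-cell whose boundary is already present is included independently with probability $p_k$.) Upper model: $Z_d(n,\mathbf p)=\bigcup_{\sigma\in\mathcal X(n,\mathbf p)}\{\sigma':\sigma'\subseteq\sigma\}$, the smallest simplicial complex containing $\mathcal X(n,\mathbf p)$. *)

(* Defs.v *)
From HB Require Import structures.
From mathcomp Require Export all_boot all_order all_algebra finmap.
From mathcomp Require Export all_classical all_reals all_analysis.
Export Order.TTheory GRing.Theory Num.Theory.
Export numFieldNormedType.Exports.

#[export] Set Implicit Arguments.
#[export] Unset Strict Implicit.
#[export] Unset Printing Implicit Defensive.

Local Open Scope classical_set_scope.
Local Open Scope ring_scope.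

Section SimplicialComplexes.
Variable V : finType.
Implicit Types (X H : {set {set V}}) (s t : {set V}) (j : nat).

Definition is_complex X : Prop :=
  forall s t, s \in X -> t \subset s -> t \in X.

(* A [j]-cell has [j + 1] vertices. *)
Definition cells X j : {set {set V}} := [set s in X | #|s| == j.+1].

Definition maximal_cells X j : {set {set V}} :=
  [set s in cells X j | ~~ [exists t in cells X j.+1, s \subset t]].

(* A ratio with denominator [0] is [0], since [0^-1 = 0] in a MathComp field. *)
Definition maximal_ratio (R : realType) X j : R :=
  #|maximal_cells X j|%:R / #|cells X j|%:R.

Definition lower_complex (d : nat) H : {set {set V}} :=
  [set s : {set V} | (#|s| <= d.+1)%N &&
     [forall t : {set V}, (t \subset s) && (2 <= #|t|)%N ==> (t \in H)]].

Definition upper_complex H : {set {set V}} :=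
  (\bigcup_(s in H) powerset s)%SET.

Lemma lower_complexP d H : is_complex (lower_complex d H).
Proof.
move=> s t; rewrite !inE => /andP[sd /forallP sH] ts.
rewrite (leq_trans (subset_leq_card ts) sd); apply/forallP => u.
apply/implyP => /andP[ut u2]; apply: (implyP (sH u)).
by rewrite (fintype.subset_trans ut ts).
Qed.

Lemma upper_complexP H : is_complex (upper_complex H).
Proof.
move=> s t /finset.bigcupP[u uH]; rewrite inE => su ts.
by apply/finset.bigcupP; exists u => //; rewrite inE (fintype.subset_trans ts su).
Qed.

Lemma upper_complex_min H X : is_complex X -> H \subset X ->
  upper_complex H \subset X.
Proof.
move=> cX /fintype.subsetP HX; apply/fintype.subsetP => s.
by case/finset.bigcupP => u /HX uX; rewrite inE; exact: cX.
Qed.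

End SimplicialComplexes.

(* The admissible hyperedges on [n] vertices: those with [2] to [d + 1]
   elements. *)
Definition hyperedge (d n : nat) (t : {set 'I_n}) : bool :=
  (2 <= #|t| <= d.+1)%N.

Definition hypergraph (d n : nat) (chi : {set 'I_n} -> bool) :
    {set {set 'I_n}} :=
  [set t | hyperedge d t && chi t].

Section Probability.
Context {dT : measure_display} {T : measurableType dT} {R : realType}.
Variable P : probability T R.

(* Mutual independence of the [X i], [i \in A]: the product rule for every
   finite subfamily and all measurable events. *)
Definition independent_RVs {dS : measure_display} {S : measurableType dS}
    {I : choiceType} (A : set I) (X : I -> {RV P >-> S}) : Prop :=
  forall J : {fset I}, [set` J] `<=` A ->
  forall B : I -> set S, (forall i, i \in J -> measurable (B i)) ->
  P (\bigcap_(i in [set` J]) (X i @^-1` B i)) =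
  (\prod_(i <- J) P (X i @^-1` B i))%E.

Definition cvg_in_probability (X : nat -> T -> R) (c : R) : Prop :=
  forall e : R, 0 < e ->
  P [set w | e < `|X n w - c|] @[n --> \oo] --> 0%E.

Definition cvg_almost_surely (X : nat -> T -> R) (c : R) : Prop :=
  \forall w \ae P, X n w @[n --> \oo] --> c.

(* Note that [0 < #|t|.-1 <= d] whenever [hyperedge d t]. Independence is
   over all the pairs [(n, t)] jointly. *)
Definition bernoulli_faces (d : nat) (p : nat -> nat -> R)
    (chi : forall n : nat, {set 'I_n} -> {RV P >-> bool}) : Prop :=
  (forall (n : nat) (t : {set 'I_n}), hyperedge d t ->
     distribution P (chi n t) =1 bernoulli_prob (p n #|t|.-1)) /\
  independent_RVs [set i : {n : nat & {set 'I_n}} | hyperedge d (tagged i)]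
    (fun i => chi (tag i) (tagged i)).

Definition lower_model (d : nat)
    (chi : forall n : nat, {set 'I_n} -> {RV P >-> bool})
    (n : nat) (w : T) : {set {set 'I_n}} :=
  lower_complex d (hypergraph d (fun t => chi n t w)).

Definition upper_model (d : nat)
    (chi : forall n : nat, {set 'I_n} -> {RV P >-> bool})
    (n : nat) (w : T) : {set {set 'I_n}} :=
  upper_complex (hypergraph d (fun t => chi n t w)).

End Probability.

(* Main.v *)
Require Import Defs.
From mathcomp Require Import measurable_realfun ring lra zify.

(** Both parts are second-moment arguments. At a fixed [n] everything is a function
    of the random hypergraph, which takes finitely many values, so expectations are
    finite sums ([expect]) and the only probabilistic input is that a given family of
    hyperedges is entirely present, or entirely absent, with the product probability
    ([product_law]). Call [d]-sets the candidates for [(d - 1)]-cells.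

    Lower model. Let [F] be the number of [d]-sets that are cells and [M] the number of
    maximal ones. Disjoint [d]-sets are cells independently of each other and all but at
    most a fraction [d ^ 2 / n] of the pairs of [d]-sets are disjoint, while each [d]-set
    is for large [n] a cell with probability at least a constant [b > 0], since the
    parameters [p 1, ..., p (d - 1)] stay away from [0]; hence [F] concentrates around
    its mean, which is at least [b * 'C(n, d)]. Given a [d]-set [s], distinct vertices
    [v] extend [s] through disjoint families of hyperedges ([star]), each present with
    probability at least [b * p d]. By Chebyshev's inequality no vertex extends [s] with
    probability at most [1 / ((n - d) * b * p d)], which tends to [0]. Thus [M] is
    negligible in mean and [M / F] tends to [0] in mean, hence in probability
    ([expect_lower_ratio_le], [lower_ratio_cvg]).

    Upper model. A maximal [(d - 1)]-cell is in no hyperedge with [d + 1] elements, and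
    every [d]-set that is in one is a cell; so the ratio is at most twice the proportion
    [u] of [d]-sets that are uncovered, meaning in no such hyperedge ([upper_ratio_le]).
    The mean of [u] is [(1 - p d) ^+ (n - d)], which tends to [0] but possibly too slowly
    for a Borel-Cantelli argument on [u] itself. The variance of [u], however, is at
    most [(d + 1) / 'C(n, d)] whatever [p d] is: two [d]-sets are correlated only through
    common supersets of size [d + 1], and [m * y * (1 - y) ^+ m] is at most [1]. As
    [d] is at least [2] these variances are summable, so the series of the squared
    deviations of [u] has finite expectation and converges almost surely; its terms tend
    to [0] ([expect_uncovered_ratio_dev], [ae_cvg0_summable], [upper_ratio_cvg]). *)

Local Open Scope ring_scope.

(** * Expectations under a finite law *)

Section FiniteExpectation.
Context {R : realType} {K : finType}.
Implicit Types (mu f g : K -> R).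

Definition expect mu f : R := \sum_k f k * mu k.

Lemma eq_expect mu f g : f =1 g -> expect mu f = expect mu g.
Proof. by move=> fg; apply: eq_bigr => k _; rewrite fg. Qed.

Lemma expectD mu f g :
  expect mu (fun k => f k + g k) = expect mu f + expect mu g.
Proof. by rewrite /expect -big_split; apply: eq_bigr => k _; rewrite mulrDl. Qed.

Lemma expectZ mu a f : expect mu (fun k => a * f k) = a * expect mu f.
Proof. by rewrite /expect mulr_sumr; apply: eq_bigr => k _; rewrite mulrA. Qed.

Lemma expect_sum mu (I : finType) (S : {set I}) (f : I -> K -> R) :
  expect mu (fun k => \sum_(i in S) f i k) = \sum_(i in S) expect mu (f i).
Proof.
by rewrite /expect exchange_big; apply: eq_bigr => k _; rewrite mulr_suml.
Qed.

Variable mu : K -> R.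
Hypothesis mu_ge0 : forall k, 0 <= mu k.
Hypothesis mu_sum1 : \sum_k mu k = 1.

Lemma le_expect f g : (forall k, f k <= g k) -> expect mu f <= expect mu g.
Proof. by move=> fg; apply: ler_sum => k _; rewrite ler_wpM2r. Qed.

Lemma expect_cst a : expect mu (fun=> a) = a.
Proof. by rewrite /expect -mulr_sumr mu_sum1 mulr1. Qed.

Lemma expect_ind_ge0 (A : pred K) : 0 <= expect mu (fun k => (A k)%:R).
Proof. by apply: sumr_ge0 => k _; rewrite mulr_ge0. Qed.

Lemma expect_ind_le1 (A : pred K) : expect mu (fun k => (A k)%:R) <= 1.
Proof. by rewrite -[leRHS]expect_cst; apply: le_expect => k; case: (A k). Qed.

Section SecondMoment.
Context {I : finType}.
Variables (S : {set I}) (A : I -> pred K).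

Let a i := expect mu (fun k => (A i k)%:R).

Definition occurrences (k : K) : R := \sum_(i in S) (A i k)%:R.

Lemma expect_occurrences : expect mu occurrences = \sum_(i in S) a i.
Proof. exact: expect_sum. Qed.

Lemma variance_occurrences :
  expect mu (fun k => (occurrences k - expect mu occurrences) ^+ 2) =
  \sum_(i in S) \sum_(j in S)
    (expect mu (fun k => (A i k && A j k)%:R) - a i * a j).
Proof.
rewrite expect_occurrences.
rewrite (eq_expect _ (g := fun k => \sum_(i in S) \sum_(j in S)
  ((A i k && A j k)%:R + (- a j * (A i k)%:R + (- a i * (A j k)%:R + a i * a j))))).
  rewrite expect_sum; apply: eq_bigr => i _.
  rewrite expect_sum; apply: eq_bigr => j _.
  by rewrite !expectD !expectZ expect_cst -/(a i) -/(a j); ring.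
move=> k; rewrite /occurrences -sumrB expr2 big_distrl /=.
apply: eq_bigr => i _; rewrite big_distrr /=; apply: eq_bigr => j _.
by rewrite -mulnb natrM; ring.
Qed.

End SecondMoment.
End FiniteExpectation.

(** Truncated second-moment bound: when [F] is at least half its reference value
    [m] the ratio is at most [2 M / m]; otherwise the last term is at least [1]. *)
Lemma ratio_le_moments (R : realType) (M F m : R) : 0 <= M -> M <= F -> 0 < m ->
  M / F <= 2 / m * M + 4 / m ^+ 2 * (F - m) ^+ 2.
Proof.
move=> M0 MF m0; have [hF|hF] := leP m (2 * F).
  have F0 : 0 < F by lra.
  apply: ler_wpDr; first by rewrite mulr_ge0 ?sqr_ge0 // divr_ge0 // exprn_ge0 // ltW.
  rewrite mulrC ler_wpM2r // ler_pdivlMr // mulrC ler_pdivrMr //; lra.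
apply: ler_wpDl; first by rewrite mulr_ge0 // divr_ge0 // ltW.
apply: (@le_trans _ _ 1); last first.
  rewrite mulrAC ler_pdivlMr ?exprn_gt0 // mul1r.
  (* this product is [4 * (F - m) ^+ 2 - m ^+ 2] *)
  have : 0 <= (m - 2 * F) * (3 * m - 2 * F) by rewrite mulr_ge0 //; lra.
  nra.
have [F0|] := ltP 0 F; first by rewrite ler_pdivrMr // mul1r.
move=> F0; have -> : F = 0 by lra.
by rewrite invr0 mulr0.
Qed.

Section RandomSet.
Context {R : realType} {E : finType}.
Implicit Types (A B H : {set E}).

(** Independence of the memberships [t \in H] for [t] in [D], in the form of the
    two product rules that the moment computations use: the lower model asks for
    the presence of whole families of hyperedges, the upper model for their absence. *)
Record product_law (mu : {set E} -> R) (D : pred E) (q : E -> R) : Prop := {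
  law_ge0 : forall H, 0 <= mu H;
  law_sum1 : \sum_H mu H = 1;
  law_sub : forall A, {in A, forall t, D t} ->
    expect mu (fun H => (A \subset H)%:R) = \prod_(t in A) q t;
  law_disjoint : forall A, {in A, forall t, D t} ->
    expect mu (fun H => [disjoint A & H]%:R) = \prod_(t in A) (1 - q t) }.

Variables (mu : {set E} -> R) (D : pred E) (q : E -> R).
Hypothesis muP : product_law mu D q.

Lemma law_subM A B : {in A, forall t, D t} -> {in B, forall t, D t} ->
    [disjoint A & B] ->
  expect mu (fun H => ((A \subset H) && (B \subset H))%:R) =
  expect mu (fun H => (A \subset H)%:R) * expect mu (fun H => (B \subset H)%:R).
Proof.
move=> AD BD AB; under eq_expect do rewrite -finset.subUset.
rewrite !(law_sub muP) //; last by move=> t; rewrite !inE => /orP[/AD|/BD].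
by rewrite -bigU //=; apply: eq_bigl => t; rewrite !inE.
Qed.

End RandomSet.

(** * Families of equicardinal sets *)

Section SetCounts.
Variables d n : nat.
Implicit Types s t : {set 'I_n}.

Definition dsets : {set {set 'I_n}} := [set s : {set 'I_n} | #|s| == d].

Lemma card_dsets : #|dsets| = 'C(n, d).
Proof. by rewrite card_draws card_ord. Qed.

Lemma card_dsets_through (v : 'I_n) :
  (#|[set s : {set 'I_n} in dsets | v \in s]| <= 'C(n.-1, d.-1))%N.
Proof.
rewrite -[n in X in (_ <= X)%N]card_ord -(cardsC1 v) -cards_draws.
rewrite -(card_in_imset (f := fun s => s :\ v)); last first.
  move=> s t; rewrite !inE => /andP[_ vs] /andP[_ vt] st.
  by rewrite -(finset.setD1K vs) -(finset.setD1K vt) st.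
apply: subset_leq_card; apply/fintype.subsetP => _ /imsetP[s + ->].
rewrite !inE => /andP[/eqP sd vs]; rewrite -sd (cardsD1 v s) vs eqxx andbT.
by apply/fintype.subsetP => u; rewrite !inE => /andP[].
Qed.

(** Union bound over the [d] vertices of [s]. *)
Lemma card_dsets_meeting s : s \in dsets ->
  (#|[set t : {set 'I_n} in dsets | ~~ [disjoint s & t]]| <= d * 'C(n.-1, d.-1))%N.
Proof.
rewrite inE => /eqP sd; rewrite -[X in (X * _)%N]sd -sum_nat_const.
apply: (@leq_trans #|\bigcup_(v in s) [set t : {set 'I_n} in dsets | v \in t]|).
  apply: subset_leq_card; apply/fintype.subsetP => t; rewrite inE => /andP[td].
  case/pred0Pn => v /andP[/= vs vt].
  by apply/finset.bigcupP; exists v => //; rewrite inE td.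
elim/big_ind2: _ => [|A a B b Aa Bb|v _]; rewrite ?cards0 ?card_dsets_through //.
by rewrite (leq_trans (leq_card_setU _ _)) // leq_add.
Qed.

End SetCounts.

(** * The lower model on finitely many vertices *)

Section LowerFinite.
Context {R : realType} (d n : nat) (p : nat -> R) (mu : {set {set 'I_n}} -> R).
Hypothesis muP : product_law mu (@hyperedge d n) (fun t => p #|t|.-1).
Implicit Types (s t : {set 'I_n}) (H : {set {set 'I_n}}).

Let dsets := @dsets d n.

(** Vertices are always present, so that only subsets with at least two elements
    have to be hyperedges for [s] to be a cell. *)
Definition faces s : {set {set 'I_n}} := 
  [set t : {set 'I_n} | (t \subset s) && (2 <= #|t|)%N].

(** For a cell [s], the sets that still have to be hyperedges for [v |: s] to be
    a cell. *)
Definition star s (v : 'I_n) : {set {set 'I_n}} :=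
  [set t : {set 'I_n} in faces (v |: s) | v \in t].

Lemma mem_lower H s :
  (s \in lower_complex d H) = (#|s| <= d.+1)%N && (faces s \subset H).
Proof.
rewrite inE; congr (_ && _); apply/forallP/fintype.subsetP => [sH t|sH t].
  by rewrite inE => /(implyP (sH t)).
by apply/implyP => ts; apply: sH; rewrite inE.
Qed.

Lemma faces_hyperedge s : (#|s| <= d.+1)%N -> {in faces s, forall t, hyperedge d t}.
Proof.
move=> sd t; rewrite inE => /andP[ts t2]; rewrite /hyperedge t2 /=.
exact: leq_trans (subset_leq_card ts) sd.
Qed.

Lemma star_hyperedge s v : s \in dsets -> {in star s v, forall t, hyperedge d t}.
Proof.
rewrite inE => /eqP sd t; rewrite inE => /andP[tf _]; apply: faces_hyperedge tf.
by rewrite cardsU1 sd; case: (_ \notin _) => //; lia.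
Qed.

Lemma faces_disjoint s t : [disjoint s & t] -> [disjoint faces s & faces t].
Proof.
move=> st; apply/pred0Pn => -[u]; rewrite /= !inE => /andP[/andP[us u2] /andP[ut _]].
have : (0 < #|u|)%N by lia.
case/card_gt0P => x xu; move/pred0P: st => /(_ x) /=.
by rewrite (fintype.subsetP us _ xu) (fintype.subsetP ut _ xu).
Qed.

Lemma star_disjoint s v w : v \notin s -> v != w ->
  [disjoint star s v & star s w].
Proof.
move=> vs vw; apply/pred0Pn => -[u]; rewrite /= !inE.
case/andP => /andP[_ vu] /andP[/andP[uw _] _].
by have := fintype.subsetP uw _ vu; rewrite !inE (negPf vw) (negPf vs).
Qed.

Lemma faces_extend s v : faces (v |: s) \subset faces s :|: star s v.
Proof.
apply/fintype.subsetP => t; rewrite !inE => /andP[ts ->]; rewrite ts /= !andbT.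
case: (boolP (v \in t)) => [_|vt]; rewrite ?orbT // orbF.
apply/fintype.subsetP => u ut; have := fintype.subsetP ts _ ut; rewrite !inE.
by case/orP => // /eqP uv; rewrite uv (negPf vt) in ut.
Qed.

Section Bounds.
Variables (c : R).
Hypotheses (d_gt1 : (1 < d)%N) (c_gt0 : 0 < c) (c_le1 : c <= 1).
Hypothesis pc : forall i, (1 <= i < d)%N -> c <= p i.
Hypothesis pd : 0 < p d <= 1.

(** A crude bound: a set with at most [d + 1] elements has at most [2 ^ (d + 1)]
    subsets, and those of size [2] to [d] are hyperedges with probability at least
    [c]. *)
Definition low_prob : R := c ^+ (2 ^ d.+1).

Lemma low_prob_gt0 : 0 < low_prob.
Proof. exact: exprn_gt0. Qed.

Lemma prod_low (A : {set {set 'I_n}}) s : (#|s| <= d.+1)%N ->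
  {in A, forall t, [/\ t \subset s, (2 <= #|t|)%N & (#|t| <= d)%N]} ->
  low_prob <= \prod_(t in A) p #|t|.-1.
Proof.
move=> sd As; apply: (@le_trans _ _ (\prod_(t in A) c)).
  rewrite prodr_const; apply: ler_wiXn2l => //; first exact: ltW.
  apply: (@leq_trans #|powerset s|); last by rewrite card_powerset leq_exp2l.
  by apply/subset_leq_card/fintype.subsetP => t /As[]; rewrite inE.
apply: ler_prod => t /As[_ t2 td]; rewrite ltW //=.
by apply: pc; case: #|t| t2 td => [|[|k]].
Qed.

Lemma prob_cell_ge s : s \in dsets ->
  low_prob <= expect mu (fun H => (faces s \subset H)%:R).
Proof.
rewrite inE => /eqP sd; rewrite (law_sub muP); last first.
  by apply: faces_hyperedge; rewrite sd.
apply: (@prod_low _ s); first by rewrite sd.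
move=> t; rewrite inE => /andP[ts t2]; split => //.
by rewrite -sd subset_leq_card.
Qed.

Lemma prob_star_ge s v : s \in dsets -> v \notin s ->
  low_prob * p d <= expect mu (fun H => (star s v \subset H)%:R).
Proof.
move=> sD vs; have /eqP sd : #|s| == d by rewrite inE in sD.
have vsd : #|v |: s| = d.+1 by rewrite cardsU1 vs sd.
rewrite (law_sub muP); last exact: star_hyperedge.
(* [v |: s] contributes [p d]; the other members of the star are smaller. *)
rewrite (bigD1 (v |: s)) /=; last first.
  by rewrite !inE vsd eqxx fintype.subxx ltnS (ltnW d_gt1).
rewrite vsd /= mulrC ler_wpM2l //; first by case/andP: pd => /ltW.
rewrite (eq_bigl (mem (star s v :\ (v |: s)))); last by move=> t; rewrite !inE andbC.
apply: (@prod_low _ (v |: s)); first by rewrite vsd.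
move=> t; rewrite !inE => /andP[tv /andP[/andP[ts t2] _]]; split=> //.
by rewrite -ltnS -vsd proper_card // finset.properEneq tv.
Qed.

(** Distinct vertices extend [s] through disjoint sets of hyperedges, so the
    number of extensions has variance at most its mean, which is at least
    [(n - d) * low_prob * p d]; Chebyshev's inequality at [0] gives the bound. *)
Lemma prob_no_extension s : s \in dsets -> (d < n)%N ->
  expect mu (fun H => [forall v in ~: s, ~~ (star s v \subset H)]%:R) <=
  ((n - d)%:R * (low_prob * p d))^-1.
Proof.
move=> sD dn; have /eqP sd : #|s| == d by rewrite inE in sD.
have mu0 := law_ge0 muP; have mu1 := law_sum1 muP.
set N := occurrences (~: s) (fun v H => star s v \subset H) : _ -> R.
set m := expect mu N.
have pd0 : 0 < low_prob * p d by rewrite mulr_gt0 ?low_prob_gt0 //; case/andP: pd.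
have lem : (n - d)%:R * (low_prob * p d) <= m.
  rewrite /m expect_occurrences.
  have -> : (n - d)%N = #|~: s| by rewrite cardsCs finset.setCK card_ord sd.
  rewrite mulr_natl -sumr_const; apply: ler_sum => v; rewrite inE => vs.
  exact: prob_star_ge.
have m0 : 0 < m by apply: lt_le_trans lem; rewrite mulr_gt0 // ltr0n subn_gt0.
apply: (@le_trans _ _ (m ^-1)); last by rewrite lef_pV2 // posrE mulr_gt0 // ltr0n subn_gt0.
apply: (@le_trans _ _ (expect mu (fun H => (m ^- 2) * (N H - m) ^+ 2))).
  apply: le_expect => // H; case: forallP => [noext|_]; last first.
    by rewrite mulr_ge0 ?invr_ge0 ?sqr_ge0 // exprn_ge0 // ltW.
  rewrite /N /occurrences big1 ?sub0r; last first.
    by move=> v vs; rewrite (negPf (implyP (noext v) vs)).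
  by rewrite sqrrN mulVf // sqrf_eq0 gt_eqF.
rewrite expectZ -[leRHS]mulr1 expr2 invfM -mulrA ler_pM2l ?invr_gt0 // mulrC.
rewrite ler_pdivrMr // mul1r /m /N variance_occurrences // expect_occurrences.
apply: ler_sum => v; rewrite inE => vs; rewrite (bigD1 v) ?inE //= big1 ?addr0.
  rewrite (eq_expect _ (g := fun H => (star s v \subset H)%:R)).
    by rewrite gerBl mulr_ge0 // expect_ind_ge0.
  by move=> H; rewrite andbb.
move=> w /andP[ws wv]; rewrite (law_subM muP) ?subrr //; try exact: star_hyperedge.
by apply: star_disjoint; rewrite // eq_sym.
Qed.

(** Only pairs of intersecting [d]-sets have correlated indicators, and a covariance
    of indicators is at most [1]. *)
Lemma variance_cells_le :
  expect mu (fun H => (occurrences dsets (fun s H => faces s \subset H) H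
     - expect mu (occurrences dsets (fun s H => faces s \subset H))) ^+ 2) <=
  ('C(n, d) * (d * 'C(n.-1, d.-1)))%:R :> R.
Proof.
have mu0 := law_ge0 muP; have mu1 := law_sum1 muP.
rewrite variance_occurrences // natrM -card_dsets mulr_natl -sumr_const.
apply: ler_sum => s sD; apply: (@le_trans _ _
  (\sum_(t in [set t : {set 'I_n} in dsets | ~~ [disjoint s & t]]) 1)); last first.
  by rewrite sumr_const ler_nat card_dsets_meeting.
rewrite [leRHS](eq_bigl (fun t => (t \in dsets) && ~~ [disjoint s & t])); last first.
  by move=> t; rewrite !inE.
rewrite [leRHS]big_mkcondr; apply: ler_sum => t tD.
have hyp u : u \in dsets -> {in faces u, forall t, hyperedge d t}.
  by rewrite inE => /eqP ud; apply: faces_hyperedge; rewrite ud.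
case: (boolP [disjoint s & t]) => st /=.
  by rewrite (law_subM muP) ?subrr; [|exact: hyp|exact: hyp|exact: faces_disjoint].
rewrite lerBlDr ler_wpDr ?expect_ind_le1 //.
by rewrite mulr_ge0 // expect_ind_ge0.
Qed.

Lemma card_lower_cells H :
  #|cells (lower_complex d H) d.-1|%:R
  = occurrences dsets (fun s H => faces s \subset H) H :> R.
Proof.
rewrite /occurrences -sum1_card natr_sum [LHS](eq_bigl (fun s =>
  (s \in dsets) && (faces s \subset H))); last first.
  move=> s; rewrite inE mem_lower [s \in dsets]inE prednK ?(ltnW d_gt1) // andbC.
  by case: eqP => //= ->; rewrite leqnSn.
by rewrite big_mkcondr; apply: eq_bigr => s _; case: (_ \subset _).
Qed.

Lemma card_lower_maximal_le H :
  #|maximal_cells (lower_complex d H) d.-1|%:R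
  <= occurrences dsets (fun s H => [forall v in ~: s, ~~ (star s v \subset H)]) H :> R.
Proof.
have d0 : (0 < d)%N by exact: ltnW.
rewrite /occurrences -sum1_card natr_sum.
rewrite (eq_bigl (fun s => (s \in dsets) &&
    (s \in maximal_cells (lower_complex d H) d.-1))); last first.
  move=> s; rewrite !inE prednK //.
  by case: (#|s| == d); rewrite // ?andbF.
rewrite big_mkcondr; apply: ler_sum => s sD.
have /eqP sd : #|s| == d by rewrite inE in sD.
case: ifP => //; rewrite inE => /andP[+ /existsPn smax].
rewrite inE mem_lower => /andP[/andP[_ fs] _].
suff -> : [forall v in ~: s, ~~ (star s v \subset H)] by [].
apply/forall_inP => v; rewrite inE => vs; apply/negP => svH.
have /negP[] := smax (v |: s); rewrite inE mem_lower cardsU1 vs sd prednK //.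
rewrite leqnn eqxx finset.subsetUr !andbT /=.
by rewrite (fintype.subset_trans (faces_extend s v)) // finset.subUset fs.
Qed.

(** Expectation of [ratio_le_moments], with the number of [d]-sets that no vertex
    extends as an upper bound for the number of maximal cells. The first summand is
    the mean proportion of such sets over that of the cells, the second one is
    the relative variance of the number of cells. *)
Lemma expect_lower_ratio_le : (d < n)%N ->
  expect mu (fun H => maximal_ratio R (lower_complex d H) d.-1) <=
  2 / low_prob * ((n - d)%:R * (low_prob * p d))^-1
  + 4 / low_prob ^+ 2 * (d ^ 2)%:R / n%:R.
Proof.
move=> dn; have mu0 := law_ge0 muP; have mu1 := law_sum1 muP.
have b0 := low_prob_gt0.
pose Nx : _ -> R := occurrences dsets
  (fun s H => [forall v in ~: s, ~~ (star s v \subset H)]).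
pose F : _ -> R := occurrences dsets (fun s H => faces s \subset H).
set m := expect mu F.
set C : R := 'C(n, d)%:R; have C0 : 0 < C by rewrite ltr0n bin_gt0 ltnW.
have mC : C * low_prob <= m.
  rewrite /m expect_occurrences /C -card_dsets mulr_natl -sumr_const.
  by apply: ler_sum => s sD; apply: prob_cell_ge.
have m0 : 0 < m by apply: lt_le_trans mC; rewrite mulr_gt0.
have ENx : expect mu Nx <= C * ((n - d)%:R * (low_prob * p d))^-1.
  rewrite expect_occurrences /C -card_dsets mulr_natl -sumr_const.
  by apply: ler_sum => s sD; apply: prob_no_extension.
apply: (@le_trans _ _ (expect mu (fun H =>
   2 / m * Nx H + 4 / m ^+ 2 * (F H - m) ^+ 2))).
  apply: le_expect => // H.
  apply: (@le_trans _ _ (2 / m * #|maximal_cells (lower_complex d H) d.-1|%:R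
     + 4 / m ^+ 2 * (F H - m) ^+ 2)).
    rewrite /maximal_ratio card_lower_cells; apply: ratio_le_moments => //.
    rewrite /F -card_lower_cells ler_nat; apply: subset_leq_card.
    by apply/fintype.subsetP => s; rewrite inE => /andP[].
  by rewrite lerD2r ler_pM2l ?card_lower_maximal_le // divr_gt0.
rewrite expectD !expectZ; apply: lerD.
  apply: (@le_trans _ _ (2 / (C * low_prob) * (C * ((n - d)%:R * (low_prob * p d))^-1))).
    apply: ler_pM => //; first by rewrite divr_ge0 // ltW.
      by apply: sumr_ge0 => H _; rewrite mulr_ge0 // sumr_ge0.
    by rewrite ler_wpM2l // lef_pV2 // posrE mulr_gt0.
  by rewrite invfM !mulrA (mulrAC _ _ C) divfK ?gt_eqF // mulrAC.
apply: (@le_trans _ _ (4 / (C * low_prob) ^+ 2 * ('C(n, d) * (d * 'C(n.-1, d.-1)))%:R)).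
  apply: ler_pM; last exact: variance_cells_le.
  - by rewrite divr_ge0 // exprn_ge0 // ltW.
  - by apply: sumr_ge0 => H _; rewrite mulr_ge0 // sqr_ge0.
  rewrite ler_wpM2l // lef_pV2 ?posrE ?exprn_gt0 ?mulr_gt0 //.
  by rewrite lerXn2r ?nnegrE ?mulr_ge0 // ltW.
have n0 : (n%:R : R) != 0 by rewrite pnatr_eq0; lia.
have nC : n%:R * 'C(n.-1, d.-1)%:R = d%:R * C.
  rewrite /C -!natrM; congr (_%:R).
  by rewrite mul_bin_diag (prednK (ltnW d_gt1)).
rewrite [leLHS](_ : _ = 4 / low_prob ^+ 2 * (d ^ 2)%:R / n%:R) //.
rewrite !natrM -/C (_ : 'C(n.-1, d.-1)%:R = d%:R * C / n%:R); last first.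
  by rewrite -nC mulrAC divff ?mul1r.
have Cn0 := gt_eqF C0; have bn0 := gt_eqF b0.
by field; rewrite Cn0 bn0 n0.
Qed.

End Bounds.
End LowerFinite.

(** * The upper model on finitely many vertices *)

Section Powers.
Context {R : realType} (y : R).
Hypothesis y01 : 0 <= y <= 1.

Lemma pow_compl_le k : 1 - (1 - y) ^+ k <= k%:R * y.
Proof.
case/andP: y01 => y0 y1; elim: k => [|k IH]; first by rewrite expr0 subrr mul0r.
have x0 : 0 <= (1 - y) ^+ k by rewrite exprn_ge0 // subr_ge0.
have x1 : (1 - y) ^+ k <= 1 by rewrite exprn_ile1 //; lra.
by rewrite exprS -natr1 mulrDl mul1r; nra.
Qed.

Lemma pow_compl_mul_le1 m : (1 + m%:R * y) * (1 - y) ^+ m <= 1.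
Proof.
case/andP: y01 => y0 y1; elim: m => [|m]; first by rewrite mul0r addr0 mul1r.
apply: le_trans; rewrite exprS mulrA ler_wpM2r ?exprn_ge0 ?subr_ge0 //.
have m0 : 0 <= m%:R :> R by [].
by rewrite -natr1; nra.
Qed.

End Powers.

Section UpperFinite.
Context {R : realType} (d n : nat).
Hypothesis d_gt0 : (0 < d)%N.
Implicit Types (s t : {set 'I_n}) (H : {set {set 'I_n}}).

Let dsets := @dsets d n.

Definition cofaces s : {set {set 'I_n}} :=
  [set t : {set 'I_n} | (s \subset t) && (#|t| == d.+1)].

Lemma cofaces_hyperedge s : {in cofaces s, forall t, hyperedge d t}.
Proof.
by move=> t; rewrite inE => /andP[_ /eqP td]; rewrite /hyperedge td ltnS d_gt0 /=.
Qed.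

Lemma card_cofaces s : s \in dsets -> #|cofaces s| = (n - d)%N.
Proof.
rewrite inE => /eqP sd.
have -> : (n - d)%N = #|~: s| by rewrite cardsCs finset.setCK card_ord sd.
rewrite -(card_in_imset (f := fun v => v |: s) (D := ~: s)); last first.
  move=> v w; rewrite !inE => vs ws vw.
  have : v \in w |: s by rewrite -vw setU11.
  by rewrite !inE (negPf vs) orbF => /eqP.
apply: eq_card => t; rewrite inE; apply/andP/imsetP => [[st /eqP td]|[v + ->]].
  have : #|t :\: s| == 1 by rewrite cardsDS // td sd subSnn.
  case/cards1P => v tv; have : v \in t :\: s by rewrite tv set11.
  rewrite inE => /andP[vs vt]; exists v; rewrite ?inE //.
  rewrite -tv; apply/finset.setP => u; rewrite !inE.
  by case: (boolP (u \in s)) => [/(fintype.subsetP st) ->|_]; rewrite ?orbT ?orbF.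
by rewrite inE => vs; rewrite finset.subsetUr cardsU1 vs sd.
Qed.

Lemma card_dsets_sub t : #|t| == d.+1 ->
  #|[set s : {set 'I_n} in dsets | s \subset t]| = d.+1.
Proof.
move=> /eqP td; rewrite -[RHS](binSn d) -td -cards_draws.
by apply: eq_card => s; rewrite !inE andbC.
Qed.

Definition uncovered s H : bool := [disjoint cofaces s & H].

Definition uncovered_ratio H : R := occurrences dsets uncovered H / 'C(n, d)%:R.

(** A hyperedge with [d + 1] elements containing [s] would be a [d]-cell above [s]. *)
Lemma upper_maximal_uncovered H :
  maximal_cells (upper_complex H) d.-1 \subset [set s in dsets | uncovered s H].
Proof.
apply/fintype.subsetP => s; rewrite !inE prednK // => /andP[/andP[sZ ->] /existsPn smax].
apply/pred0Pn => -[t] /=; rewrite inE => /andP[/andP[st td] tH].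
have /negP[] := smax t; rewrite !inE td st !andbT.
by apply/finset.bigcupP; exists t => //; rewrite inE.
Qed.

Lemma covered_upper_cells H :
  [set s in dsets | ~~ uncovered s H] \subset cells (upper_complex H) d.-1.
Proof.
apply/fintype.subsetP => s; rewrite !inE prednK // => /andP[-> /pred0Pn[t]].
rewrite /= inE andbT => /andP[/andP[st _] tH].
by apply/finset.bigcupP; exists t => //; rewrite inE.
Qed.

(** If at most half of the [d]-sets are uncovered, at least half of them are cells;
    otherwise the bound exceeds [1]. Without any [d]-set both sides are [0]. *)
Lemma upper_ratio_le H : maximal_ratio R (upper_complex H) d.-1 <= 2 * uncovered_ratio H.
Proof.
rewrite /maximal_ratio /uncovered_ratio.
set M := #|maximal_cells _ _|; set F := #|cells _ _|.
pose U := #|[set s in dsets | uncovered s H]|.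
have -> : occurrences dsets uncovered H = U%:R :> R.
  rewrite /occurrences /U -sum1_card natr_sum [RHS](eq_bigl (fun s =>
    (s \in dsets) && uncovered s H)); last by move=> s; rewrite inE.
  by rewrite big_mkcondr; apply: eq_bigr => s _; case: uncovered.
have MU : (M <= U)%N by apply/subset_leq_card/upper_maximal_uncovered.
have MF : (M <= F)%N.
  by apply/subset_leq_card/fintype.subsetP => s; rewrite inE => /andP[].
have CUF : ('C(n, d) <= U + F)%N.
  rewrite -card_dsets -(cardsID [set s : {set 'I_n} | uncovered s H]) leq_add //.
    by apply/subset_leq_card/fintype.subsetP => s; rewrite !inE.
  apply: leq_trans (subset_leq_card (covered_upper_cells H)).
  by apply/subset_leq_card/fintype.subsetP => s; rewrite !inE andbC.
have [F0|F0] := posnP F.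
  by rewrite F0 invr0 mulr0 mulr_ge0 // divr_ge0.
have [C0|C0] := posnP 'C(n, d); last first.
  rewrite ler_pdivrMr ?ltr0n // mulrA [leRHS]mulrAC ler_pdivlMr ?ltr0n //.
  rewrite -!natrM ler_nat.
  have [h|h] := leqP (2 * F) 'C(n, d).
    by have := leq_mul MF (leqnn 'C(n, d)); nia.
  by have := leq_mul MU (ltnW h); nia.
suff -> : M = 0%N by rewrite mul0r mulr_ge0 // divr_ge0.
apply/eqP; rewrite -leqn0 -C0 -card_dsets; apply: leq_trans MU _.
by apply/subset_leq_card/fintype.subsetP => s; rewrite !inE => /andP[].
Qed.

Variables (p : nat -> R) (mu : {set {set 'I_n}} -> R).
Hypothesis muP : product_law mu (@hyperedge d n) (fun t => p #|t|.-1).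
Hypothesis pd : 0 <= p d <= 1.

Lemma expect_uncovered s : s \in dsets ->
  expect mu (fun H => (uncovered s H)%:R) = (1 - p d) ^+ (n - d).
Proof.
move=> sD; rewrite (law_disjoint muP); last exact: cofaces_hyperedge.
rewrite -(card_cofaces sD) -prodr_const; apply: eq_bigr => t.
by rewrite inE => /andP[_ /eqP ->].
Qed.

(** Let [x] be [1 - p d], [m] be [n - d] and [k] be the number of common cofaces. Then
    [2 * m - k] hyperedges have to be absent for both sets to be uncovered, so the
    covariance is [x ^ (2 * m - k) * (1 - x ^ k)]; as [k] is at most [m], it is at most
    [x ^ m * (k * p d)]. *)
Lemma cov_uncovered_le s t : s \in dsets -> t \in dsets ->
  expect mu (fun H => (uncovered s H && uncovered t H)%:R)
   - expect mu (fun H => (uncovered s H)%:R) * expect mu (fun H => (uncovered t H)%:R)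
  <= #|cofaces s :&: cofaces t|%:R * (p d * (1 - p d) ^+ (n - d)).
Proof.
move=> sD tD; rewrite !expect_uncovered // -exprD.
rewrite (eq_expect _ (g := fun H => [disjoint cofaces s :|: cofaces t & H]%:R)); last first.
  by move=> H; rewrite /uncovered -!finset.setI_eq0 finset.setIUl finset.setU_eq0.
rewrite (law_disjoint muP); last first.
  by move=> u; rewrite inE => /orP[]; apply: cofaces_hyperedge.
rewrite (eq_bigr (fun=> 1 - p d)); last first.
  by move=> u; rewrite !inE => /orP[]/andP[_ /eqP ->].
rewrite prodr_const; set k := #|cofaces s :&: cofaces t|.
have kU : (#|cofaces s :|: cofaces t| + k = (n - d) + (n - d))%N.
  by rewrite -{1}(card_cofaces sD) -(card_cofaces tD) cardsUI.
have km : (k <= n - d)%N by rewrite -(card_cofaces sD) subset_leq_card // finset.subsetIl.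
rewrite -kU exprD; set a := #|_ :|: _| in kU *.
have am : (n - d <= a)%N by lia.
have x0 : 0 <= 1 - p d <= 1 by case/andP: pd => *; apply/andP; split; lra.
case/andP: (x0) => x0' x1.
rewrite -[X in X - _]mulr1 -mulrBr mulrC mulrA.
apply: ler_pM; rewrite ?subr_ge0 ?exprn_ile1 ?exprn_ge0 ?pow_compl_le //.
exact: ler_wiXn2l.
Qed.

(** A [d]-set has [m = n - d] cofaces, each with [d + 1] subsets of size [d], so by
    [cov_uncovered_le] its covariances sum to at most
    [(d + 1) * (m * p d * (1 - p d) ^ m)], where the last factor is at most [1]
    for all values of [p d]. *)
Lemma variance_uncovered_le :
  expect mu (fun H => (occurrences dsets uncovered H
     - expect mu (occurrences dsets uncovered)) ^+ 2) <= ('C(n, d) * d.+1)%:R :> R.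
Proof.
have mu1 := law_sum1 muP; set y := p d * (1 - p d) ^+ (n - d).
rewrite variance_occurrences // natrM -card_dsets mulr_natl -sumr_const.
apply: ler_sum => s sD.
apply: (@le_trans _ _ (\sum_(t in dsets) #|cofaces s :&: cofaces t|%:R * y)).
  by apply: ler_sum => t tD; apply: cov_uncovered_le.
rewrite -mulr_suml -natr_sum.
have -> : (\sum_(t in dsets) #|cofaces s :&: cofaces t| = (n - d) * d.+1)%N.
  rewrite -(card_cofaces sD) -sum_nat_const.
  under eq_bigr do rewrite -sum1_card.
  (* count the pairs of a [d]-set [t] and a common coface of [s] and [t] by cofaces *)
  rewrite (exchange_big_dep (mem (cofaces s))) /=; last first.
    by move=> t u _; rewrite inE => /andP[].
  apply: eq_bigr => u us; have /andP[_ ud] : (s \subset u) && (#|u| == d.+1).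
    by rewrite inE in us.
  rewrite -[RHS](card_dsets_sub ud) -sum1_card; apply: eq_bigl => t.
  by rewrite inE finset.in_setI us [u \in cofaces t]inE ud andbT.
rewrite natrM mulrAC -[leRHS]mul1r ler_wpM2r // /y mulrA.
apply: le_trans (pow_compl_mul_le1 pd (n - d)); rewrite ler_wpM2r //.
  by rewrite exprn_ge0 // subr_ge0; case/andP: pd.
by rewrite lerDr.
Qed.

Lemma expect_uncovered_ratio_dev : (d <= n)%N ->
  expect mu (fun H => (uncovered_ratio H - (1 - p d) ^+ (n - d)) ^+ 2) <=
  d.+1%:R / 'C(n, d)%:R.
Proof.
move=> dn; set C : R := 'C(n, d)%:R; have C0 : 0 < C by rewrite ltr0n bin_gt0.
have Cn0 := gt_eqF C0.
have EU : expect mu (occurrences dsets uncovered) = C * (1 - p d) ^+ (n - d).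
  rewrite expect_occurrences (eq_bigr _ expect_uncovered) sumr_const card_dsets.
  by rewrite -mulr_natl.
rewrite (eq_expect _ (g := fun H => C ^- 2 * (occurrences dsets uncovered H
     - expect mu (occurrences dsets uncovered)) ^+ 2)); last first.
  by move=> H; rewrite EU /uncovered_ratio -/C; field; rewrite Cn0.
rewrite expectZ; apply: le_trans (ler_wpM2l _ variance_uncovered_le) _.
  by rewrite invr_ge0 exprn_ge0 // ltW.
by rewrite natrM -/C (_ : _ * _ = d.+1%:R / C) //; field; rewrite Cn0.
Qed.

End UpperFinite.

(** * Laws of random elements of a finite type *)

Local Open Scope classical_set_scope.
Local Open Scope ring_scope.

Section FiniteLaw.
Context {dT : measure_display} {T : measurableType dT} {R : realType}.
Variables (P : probability T R) (K : finType) (X : T -> K).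
Hypothesis mX : forall k, measurable (X @^-1` [set k]).

Definition law (k : K) : R := fine (P (X @^-1` [set k])).

Lemma measurable_preimage_fin (B : set K) : measurable (X @^-1` B).
Proof.
rewrite (_ : _ @^-1` _ = \bigcup_(k in B) X @^-1` [set k]).
  by apply: fin_bigcup_measurable => //; exact: finite_finset.
apply/seteqP; split => [w Bw|w [k Bk /= Xw]]; first by exists (X w).
by rewrite /preimage /= Xw.
Qed.

Lemma lawE k : (law k)%:E = P (X @^-1` [set k]).
Proof. by rewrite /law fineK // fin_num_measure. Qed.

Lemma measurable_comp_fin (f : K -> R) :
  measurable_fun setT (fun w => (f (X w))%:E).
Proof.
move=> _ Y mY; rewrite setTI.
exact: (measurable_preimage_fin ((EFin \o f) @^-1` Y)).
Qed.

Lemma integral_comp_fin (f : K -> R) : (forall k, 0 <= f k) ->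
  (\int[P]_w (f (X w))%:E = (expect law f)%:E)%E.
Proof.
move=> f0; under eq_integral => w _.
  rewrite (_ : (f (X w))%:E = \sum_k (f k)%:E * (\1_(X @^-1` [set k]) w)%:E)%E; last first.
    rewrite (bigD1 (X w)) //= big1 ?adde0 ?indicE ?mem_set ?mule1 // => k kX.
    by rewrite indicE memNset ?mule0 //= => Xk; rewrite Xk eqxx in kX.
  over.
rewrite ge0_integral_sum //; last 2 first.
- move=> k; apply: measurable_funeM; apply/measurable_EFinP.
  exact: measurable_indic.
- by move=> k w _; rewrite mule_ge0 // lee_fin.
rewrite /expect -sumEFin; apply: eq_bigr => k _.
rewrite ge0_integralZl_EFin //; last 1 first.
- by apply/measurable_EFinP; exact: measurable_indic.
by rewrite integral_indic // setIT EFinM lawE.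
Qed.

Lemma law_ind (A : pred K) :
  (expect law (fun k => (A k)%:R))%:E = P [set w | A (X w)].
Proof.
rewrite -integral_comp_fin //.
rewrite (_ : [set w | A (X w)] = X @^-1` [set k | A k]) //.
rewrite -[X in P X]setIT -integral_indic //; last exact: measurable_preimage_fin.
by apply: eq_integral => w _; rewrite indicE mem_setE /=.
Qed.

Lemma law_markov (f : K -> R) (e : R) : (forall k, 0 <= f k) -> 0 < e ->
  (P [set w | (e < f (X w))%R] <= (expect law f / e)%:E)%E.
Proof.
move=> f0 e0; rewrite -(law_ind (fun k => e < f k)) lee_fin ler_pdivlMr //.
rewrite mulrC -expectZ; apply: ler_sum => k _.
rewrite ler_wpM2r ?fine_ge0 //; case: ltP => [/ltW|_]; rewrite ?mulr1 ?mulr0 //.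
Qed.

End FiniteLaw.

(** * The law of the random hypergraph *)

Section Hypergraph.
Context {R : realType} {dT : measure_display} {T : measurableType dT}.
Variables (P : probability T R) (d : nat) (p : nat -> nat -> R).
Hypothesis p01 : forall n k : nat, (1 <= k <= d)%N -> 0 < p n k <= 1.
Variable chi : forall n : nat, {set 'I_n} -> {RV P >-> bool}.
Hypothesis chiP : bernoulli_faces d p chi.
Variable n : nat.

Definition random_hypergraph (w : T) : {set {set 'I_n}} :=
  hypergraph d (fun t => chi t w).

Lemma measurable_random_hypergraph H :
  measurable (random_hypergraph @^-1` [set H]).
Proof.
rewrite (_ : _ @^-1` _ = \bigcap_(t in [set: {set 'I_n}])
    (chi t @^-1` [set b | (hyperedge d t && b) = (t \in H)])).
  apply: fin_bigcap_measurable => // t _.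
  by rewrite -[X in measurable X]setTI; exact: measurable_funP.
apply/seteqP; split => w /=.
  by move=> <- t _ /=; rewrite inE.
by move=> wH; apply/finset.setP => t; rewrite inE; exact: wH.
Qed.

(** The independent family is indexed by pairs [(n, t)]: the set [A] is carried to
    it by the injection of [t] as [(n, t)]. *)
Lemma prob_constant_on (A : {set {set 'I_n}}) (b : bool) :
  {in A, forall t, hyperedge d t} ->
  P [set w | [forall t in A, chi t w == b]] =
  (\prod_(t in A) (if b then p n #|t|.-1 else 1 - p n #|t|.-1))%:E.
Proof.
move=> AD; have [ber ind] := chiP.
pose tg (t : {set 'I_n}) := existT (fun n => {set 'I_n}) n t.
have tgI : injective tg by move=> s t /eqP; rewrite eq_Tagged => /eqP.
have := ind [fset tg t | t in A]%fset _ (fun=> [set b]) _.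
rewrite big_imfset /=; last by move=> s t _ _; apply: tgI.
move=> /(_ _ _) indA.
rewrite (_ : [set w | _] = \bigcap_(i in [set` [fset tg t | t in A]%fset])
    (chi (tagged i) @^-1` [set b])); last first.
  apply/seteqP; split => w /=.
    by move=> /forall_inP wA i /imfsetP[t /= tA ->]; apply/eqP/wA.
  by move=> wA; apply/forall_inP => t tA; apply/eqP/(wA (tg t))/in_imfset.
rewrite {}indA //; last by move=> i /imfsetP[t /= tA ->]; exact: AD.
rewrite -prodEFin -[RHS]big_enum.
rewrite [RHS]big_seq [LHS]big_seq; apply: eq_bigr => t; rewrite mem_enum => tA.
have tD := AD t tA; rewrite -[LHS]/(distribution P (chi t) [set b]) ber //.
have /andP[q0 q1] : 0 < p n #|t|.-1 <= 1.
  by apply: p01; move: tD; rewrite /hyperedge; case: #|t| => [|[|k]].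
have p01' : 0 <= p n #|t|.-1 <= 1 by rewrite ltW.
rewrite (bernoulli_probE p01') /dirac !indicE !classical_sets.in_set1; case: b => /=.
  by rewrite mule1 mule0 adde0.
by rewrite mule1 mule0 add0e.
Qed.

Lemma product_law_hypergraph :
  product_law (law P random_hypergraph) (@hyperedge d n) (fun t => p n #|t|.-1).
Proof.
have mX := measurable_random_hypergraph.
split.
- by move=> H; rewrite fine_ge0.
- have -> : \sum_H law P random_hypergraph H =
      expect (law P random_hypergraph) (fun H => (predT H)%:R).
    by apply: eq_bigr => H _ /=; rewrite mul1r.
  apply/EFin_inj; rewrite law_ind // (_ : [set _ | _] = setT) ?probability_setT //.
  exact/seteqP.
- move=> A AD; apply/EFin_inj; rewrite law_ind // -(@prob_constant_on A true AD).
  congr (P _); apply/seteqP; split => w /=.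
    move=> /fintype.subsetP Aw; apply/forall_inP => t tA.
    by have := Aw t tA; rewrite inE => /andP[_ ->].
  move=> /forall_inP Aw; apply/fintype.subsetP => t tA.
  by rewrite inE (AD t tA) (eqP (Aw t tA)).
- move=> A AD; apply/EFin_inj; rewrite law_ind // -(@prob_constant_on A false AD).
  congr (P _); apply/seteqP; split => w /=.
    move=> /pred0P Aw; apply/forall_inP => t tA.
    by have := Aw t; rewrite /= tA inE (AD t tA) /= => ->.
  move=> /forall_inP Aw; apply/pred0P => t /=; apply/negP => /andP[tA].
  by rewrite inE (eqP (Aw t tA)) andbF.
Qed.

End Hypergraph.

(** * Limits of sequences *)

Section Asymptotics.
Context {R : realType}.
Implicit Types (u : nat -> R).

Lemma bigmine_gt0 (F : nat -> \bar R) (a b i : nat) :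
  (0 < \big[mine/+oo]_(a <= k < b) F k)%E -> (a <= i < b)%N -> (0 < F i)%E.
Proof.
rewrite -mem_index_iota; elim: (index_iota a b) => // k r IH.
rewrite big_cons lt_min inE => /andP[Fk Fr] /orP[/eqP -> //|].
exact: IH.
Qed.

Lemma limn_einf_gt0 u : (0 < limn_einf (fun n => (u n)%:E))%E ->
  exists2 c : R, 0 < c & \forall n \near \oo, c <= u n.
Proof.
rewrite limn_einf_lim (cvg_lim _ (cvg_einfs_sup (u := _))) //.
case/ereal_sup_gt => _ [N _ <-] u0.
have le_u n : (N <= n)%N -> (einfs (fun n => (u n)%:E) N <= (u n)%:E)%E.
  by move=> Nn; apply: ereal_inf_lbound; exists n.
case: (einfs _ N) u0 le_u => [c||] // c0 le_u; last first.
  by have := le_u N (leqnn N).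
exists c; first by rewrite -lte_fin.
by exists N => // n /= Nn; rewrite -lee_fin; apply: le_u.
Qed.

Lemma uniform_lower_bound (p : nat -> nat -> R) (d : nat) :
  (0 < \big[mine/+oo]_(1 <= i < d) limn_einf (fun n => (p n i)%:E))%E ->
  exists c : R, [/\ 0 < c, c <= 1 &
    \forall n \near \oo, forall i, (1 <= i < d)%N -> c <= p n i].
Proof.
move=> pos.
suff [c [c0 c1 cP]] : exists c : R, [/\ 0 < c, c <= 1 &
    \forall n \near \oo, {in index_iota 1 d, forall i, c <= p n i}].
  exists c; split => //; near=> n => i; rewrite -mem_index_iota; move: i.
  by near: n.
have : {in index_iota 1 d, forall i, (0 < limn_einf (fun n => (p n i)%:E))%E}.
  by move=> i; rewrite mem_index_iota; move/(bigmine_gt0 pos).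
elim: (index_iota 1 d) => [_|k r IH kr].
  by exists 1; split => //; near=> n.
have [|c [c0 c1 cP]] := IH.
  by move=> i ir; apply: kr; rewrite inE ir orbT.
have [e e0 eP] := limn_einf_gt0 (kr k (mem_head k r)).
exists (Num.min c e); split; first by rewrite lt_min c0.
  by rewrite ge_min c1.
near=> n => i; rewrite inE => /orP[/eqP ->|ir]; rewrite ge_min.
  by apply/orP; right; near: n.
by apply/orP; left; move: i ir; near: n.
Unshelve. all: by end_near. Qed.

Lemma cvgy_mul_compl (u : nat -> R) : (\forall n \near \oo, 0 <= u n <= 1) ->
  n%:R * u n * (1 - u n) @[n --> \oo] --> +oo -> n%:R * u n @[n --> \oo] --> +oo.
Proof.
move=> u01 /cvgryPge nu; apply/cvgryPge => A.
near=> n; apply: (@le_trans _ _ (n%:R * u n * (1 - u n))); first by near: n.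
have /andP[u0 u1] : 0 <= u n <= 1 by near: n.
by rewrite ler_piMr ?mulr_ge0 // gerBl.
Unshelve. all: by end_near. Qed.

(** Replacing [n] by [n - d] costs at most [d], as [u n <= 1]. *)
Lemma cvgy_subn_mul (u : nat -> R) (d : nat) : (\forall n \near \oo, 0 <= u n <= 1) ->
  n%:R * u n @[n --> \oo] --> +oo -> (n - d)%N%:R * u n @[n --> \oo] --> +oo.
Proof.
move=> u01 /cvgryPge nu; apply/cvgryPge => A.
near=> n.
have h : A + d%:R <= n%:R * u n by near: n.
have /andP[u0 u1] : 0 <= u n <= 1 by near: n.
have dn : (d <= n)%N by near: n; exact: nbhs_infty_ge.
rewrite natrB // mulrBl; have : d%:R * u n <= d%:R by rewrite ler_piMr.
lra.
Unshelve. all: by end_near. Qed.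

(** ['C(k + d, d)] is at least ['C(k + 2, 2)], whose inverse is the increment of a
    bounded sequence: this makes the variances of the upper model summable. *)
Lemma inv_binomial_le (d k : nat) : (2 <= d)%N ->
  'C(k + d, d)%:R^-1 <= 2 * (k.+1%:R^-1 - k.+2%:R^-1) :> R.
Proof.
move=> d2; have C2 : (k.+2 * k.+1 <= 2 * 'C(k + d, d))%N.
  have -> : (k.+2 * k.+1 = 2 * 'C(k.+2, 2))%N by rewrite -mul_bin_diag /= bin1.
  rewrite leq_mul2l -(bin_sub (leq_addl k d)) addnK.
  rewrite (_ : 'C(k.+2, 2) = 'C(k.+2, k)); first by apply: leq_bin2l; lia.
  by rewrite -bin_sub //; congr 'C(_, _); lia.
have C0 : 0 < 'C(k + d, d)%:R :> R by rewrite ltr0n bin_gt0 leq_addl.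
have k0 : 0 <= k%:R :> R by [].
move: C2; rewrite -(ler_nat R) !natrM => C2.
rewrite [leRHS](_ : _ = 2 / (k.+2%:R * k.+1%:R)).
  by rewrite ler_pdivlMr ?mulr_gt0 // mulrC ler_pdivrMr.
by rewrite -!natr1; field; apply/andP; split; lra.
Qed.

End Asymptotics.

(** * Almost sure convergence from summable integrals *)

Section AlmostSure.
Context {dT : measure_display} {T : measurableType dT} {R : realType}.
Variable P : probability T R.

(** A series of nonnegative functions with summable integrals has integrable
    sum, so that it converges almost everywhere and its terms tend to [0]. *)
Lemma ae_cvg0_summable (f : nat -> T -> R) (b : nat -> R) (S : R) :
  (forall k w, 0 <= f k w) ->
  (forall k, measurable_fun setT (fun w => (f k w)%:E)) ->
  (forall k, (\int[P]_w (f k w)%:E <= (b k)%:E)%E) ->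
  (forall n, \sum_(0 <= k < n) b k <= S) ->
  \forall w \ae P, f k w @[k --> \oo] --> 0.
Proof.
move=> f0 mf fb bS.
have g0 w : (0 <= \sum_(0 <= k <oo) (f k w)%:E)%E.
  by apply: nneseries_ge0 => k _ _; rewrite lee_fin.
have : P.-integrable setT (fun w => \sum_(0 <= k <oo) (f k w)%:E)%E.
  apply/integrableP; split.
    by apply: ge0_emeasurable_sum => // k w _ _; rewrite lee_fin.
  under eq_integral do rewrite gee0_abs //.
  rewrite integral_nneseries //; last by move=> k w _; rewrite lee_fin.
  apply: (@le_lt_trans _ _ S%:E); last exact: ltry.
  apply: lime_le.
    by apply: is_cvg_nneseries => k _ _; apply: integral_ge0 => w _; rewrite lee_fin.
  near=> n; apply: (@le_trans _ _ (\sum_(0 <= k < n) (b k)%:E)%E).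
    by apply: lee_sum => k _; apply: fb.
  by rewrite sumEFin lee_fin.
move/(integrable_ae measurableT); apply: filterS => w /(_ I) gfin.
apply: cvg_series_cvg_0; apply: nondecreasing_is_cvgn.
  apply/nondecreasing_seqP => n.
  by rewrite /series /= big_nat_recr //= lerDl.
exists (fine (\sum_(0 <= k <oo) (f k w)%:E)%E) => _ [n _ <-].
rewrite -lee_fin fineK // /series /= -sumEFin.
by apply: nneseries_lim_ge => k _ _; rewrite lee_fin.
Unshelve. all: by end_near. Qed.

End AlmostSure.

(** * The two models as the number of vertices grows *)

Lemma maximal_ratio_ge0 (V : finType) (R : realType) (X : {set {set V}}) j :
  0 <= maximal_ratio R X j.
Proof. by rewrite divr_ge0. Qed.

Lemma cvgy_inv0 (R : realType) (u : nat -> R) :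
  u n @[n --> \oo] --> +oo -> (u n)^-1 @[n --> \oo] --> 0.
Proof. by move=> uy; apply/gtr0_cvgV0 => //; move/cvgryPgt : uy; apply. Qed.

Lemma cvg_pow_compl0 (R : realType) (y : nat -> R) (k : nat -> nat) :
  (\forall n \near \oo, 0 <= y n <= 1) -> (k n)%:R * y n @[n --> \oo] --> +oo ->
  (1 - y n) ^+ k n @[n --> \oo] --> 0.
Proof.
move=> y01 ky; apply: (squeeze_cvgr _ (cvg_cst 0) (cvgy_inv0 ky)); near=> n.
have yn : 0 <= y n <= 1 by near: n.
have ky0 : 0 < (k n)%:R * y n by near: n; move/cvgryPgt : ky; apply.
have x0 : 0 <= (1 - y n) ^+ k n by rewrite exprn_ge0 // subr_ge0; case/andP: yn.
rewrite x0 -[leRHS]mul1r ler_pdivlMr //.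
apply: le_trans (pow_compl_mul_le1 yn (k n)); rewrite mulrC.
by rewrite ler_wpM2r ?lerDr.
Unshelve. all: by end_near. Qed.

Section Models.
Context {R : realType} {dT : measure_display} {T : measurableType dT}.
Variables (P : probability T R) (d : nat) (p : nat -> nat -> R).
Hypothesis d_ge2 : (2 <= d)%N.
Hypothesis p01 : forall n k : nat, (1 <= k <= d)%N -> 0 < p n k <= 1.
Variable chi : forall n : nat, {set 'I_n} -> {RV P >-> bool}.
Hypothesis chiP : bernoulli_faces d p chi.

Let pd01 n : 0 < p n d <= 1.
Proof. by apply: p01; rewrite leqnn andbT ltnW. Qed.

Let pd01' : \forall n \near \oo, 0 <= p n d <= 1.
Proof. by near=> n; have /andP[/ltW -> ->] := pd01 n.
Unshelve. all: by end_near. Qed.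

(** Markov's inequality applied to [expect_lower_ratio_le]. *)
Lemma lower_ratio_cvg (c : R) : 0 < c -> c <= 1 ->
  (\forall n \near \oo, forall i, (1 <= i < d)%N -> c <= p n i) ->
  n%:R * p n d @[n --> \oo] --> +oo ->
  cvg_in_probability P
    (fun n w => maximal_ratio R (lower_model d chi n w) d.-1) 0.
Proof.
move=> c0 c1 pc np e e0; set b := low_prob d c.
have b0 : 0 < b by exact: low_prob_gt0.
pose B n : R :=
  2 / b * ((n - d)%N%:R * (b * p n d))^-1 + 4 / b ^+ 2 * (d ^ 2)%:R / n%:R.
have B0 : B n / e @[n --> \oo] --> 0.
  have -> : (fun n => B n / e) = (fun n =>
      (2 / b / b) / e * ((n - d)%N%:R * p n d)^-1
      + (4 / b ^+ 2 * (d ^ 2)%:R) / e * n%:R^-1).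
    by apply/funext => n; rewrite /B !invfM; ring.
  rewrite -[X in _ --> X](addr0 0); apply: cvgD.
    rewrite -[X in _ --> X](mulr0 (2 / b / b / e)); apply: cvgMl_tmp.
    exact/cvgy_inv0/cvgy_subn_mul.
  rewrite -[X in _ --> X](mulr0 (4 / b ^+ 2 * (d ^ 2)%:R / e)); apply: cvgMl_tmp.
  exact/cvgy_inv0/cvgr_idn.
apply: (@squeeze_cvge _ _ _ _ (fun=> 0%E) _ (fun n => (B n / e)%:E)).
- near=> n; rewrite measure_ge0 /=.
  have dn : (d < n)%N by near: n; exact: nbhs_infty_gt.
  have pcn : forall i, (1 <= i < d)%N -> c <= p n i by near: n.
  have muP := product_law_hypergraph p01 chiP n.
  pose f (H : {set {set 'I_n}}) : R := maximal_ratio R (lower_complex d H) d.-1.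
  have := @law_markov _ _ _ P _ _ (measurable_random_hypergraph d chi (n:=n)) f e.
  rewrite (_ : [set w | (e < f (random_hypergraph d chi n w))%R] =
    [set w | (e < `|maximal_ratio R (lower_model d chi n w) d.-1 - 0|)%R]); last first.
    by apply/seteqP; split => w /=; rewrite subr0 ger0_norm ?maximal_ratio_ge0.
  move=> /(_ (fun=> maximal_ratio_ge0 _ _ _) e0) /le_trans; apply.
  rewrite lee_fin ler_pM2r ?invr_gt0 //.
  exact: (expect_lower_ratio_le muP d_ge2 c0 c1 pcn (pd01 n) dn).
- exact: cvg_cst.
- by apply: cvg_EFin => //; near=> n.
Unshelve. all: by end_near. Qed.

(** The deviation of the uncovered proportion from its mean tends to [0] almost surely
    because its variances are summable, and the mean tends to [0]. *)
Lemma upper_ratio_cvg : n%:R * p n d @[n --> \oo] --> +oo ->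
  cvg_almost_surely P
    (fun n w => maximal_ratio R (upper_model d chi n w) d.-1) 0.
Proof.
move=> np; have d0 : (0 < d)%N by exact: ltnW.
pose q n : R := (1 - p n d) ^+ (n - d).
have q0 : q n @[n --> \oo] --> 0.
  exact/cvg_pow_compl0/cvgy_subn_mul.
pose u n w : R := uncovered_ratio d (random_hypergraph d chi n w).
(* [n = k + d] avoids the indices at which ['C(n, d)] vanishes *)
have : \forall w \ae P,
    (u (k + d)%N w - q (k + d)%N) ^+ 2 @[k --> \oo] --> (0 : R).
  apply: (@ae_cvg0_summable _ _ _ P _
    (fun k => d.+1%:R * (2 * (k.+1%:R^-1 - k.+2%:R^-1))) (d.+1%:R * 2)).
  - by move=> k w; rewrite sqr_ge0.
  - move=> k; exact: (measurable_comp_fin (measurable_random_hypergraph d chi (n:=k + d))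
      (fun H => (uncovered_ratio d H - q (k + d)%N) ^+ 2)).
  - move=> k; rewrite (integral_comp_fin P (measurable_random_hypergraph d chi (n:=k + d))
      (f := fun H => (uncovered_ratio d H - q (k + d)%N) ^+ 2)); last first.
      by move=> H; rewrite sqr_ge0.
    have muP := product_law_hypergraph p01 chiP (k + d).
    have pd : 0 <= p (k + d)%N d <= 1 by have /andP[/ltW -> ->] := pd01 (k + d).
    rewrite lee_fin; apply: le_trans (expect_uncovered_ratio_dev d0 muP pd (leq_addl _ _)) _.
    by rewrite ler_wpM2l // inv_binomial_le.
  - move=> n; rewrite -mulr_sumr ler_wpM2l // -mulr_sumr -[leRHS]mulr1 ler_wpM2l //.
    rewrite (telescope_sumr_eq (fun k => - k.+1%:R^-1)) //; last first.
      by move=> k _; rewrite opprK addrC.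
    by rewrite invr1 opprK addrC gerBl invr_ge0.
apply: filterS => w dev.
have {}dev : u n w - q n @[n --> \oo] --> (0 : R).
  rewrite -(cvg_shiftn d (fun n => u n w - q n)).
  apply/cvgr0Pnorm_lt => e e0; move/cvgr0Pnorm_lt : dev => /(_ (e ^+ 2)).
  move=> /(_ (exprn_gt0 _ e0)); apply: filterS => k /=.
  by rewrite normrX ltr_pXn2r ?nnegrE // ltW.
have u0 : u n w @[n --> \oo] --> (0 : R).
  have -> : u^~ w = (fun n => u n w - q n) \+ q.
    by apply/funext => n /=; rewrite subrK.
  by rewrite -[X in _ --> X](addr0 0); exact: cvgD.
apply: (@squeeze_cvgr _ _ _ _ (fun=> 0) (fun n => 2 * u n w)).
- by near=> n; rewrite maximal_ratio_ge0 /=; exact: upper_ratio_le.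
- exact: cvg_cst.
- by rewrite -(mulr0 2); apply: cvgMl_tmp.
Unshelve. all: by end_near. Qed.

End Models.

Theorem corollary6 (R : realType) (dT : measure_display)
    (T : measurableType dT) (P : probability T R)
    (d : nat) (d_ge2 : (2 <= d)%N)
    (p : nat -> nat -> R)
    (p01 : forall n k : nat, (1 <= k <= d)%N -> 0 < p n k <= 1)
    (chi : forall n : nat, {set 'I_n} -> {RV P >-> bool})
    (chiP : bernoulli_faces d p chi) :
  ((0 < \big[mine/+oo]_(1 <= i < d) limn_einf (fun n => (p n i)%:E))%E ->
   n%:R * p n d * (1 - p n d) @[n --> \oo] --> +oo ->
   p n d @[n --> \oo] --> 0 ->
   cvg_in_probability P
     (fun n w => maximal_ratio R (lower_model d chi n w) d.-1) 0)
  /\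
  (n%:R * p n d * (1 - p n d) @[n --> \oo] --> +oo ->
   cvg_almost_surely P
     (fun n w => maximal_ratio R (upper_model d chi n w) d.-1) 0).
Proof.
have np : n%:R * p n d * (1 - p n d) @[n --> \oo] --> +oo ->
    n%:R * p n d @[n --> \oo] --> +oo.
  apply: cvgy_mul_compl; near=> n.
  by have /andP[/ltW -> ->] : 0 < p n d <= 1 by apply: p01; rewrite leqnn andbT ltnW.
split=> [/uniform_lower_bound[c [c0 c1 pc]] /np + _ | /np].
  exact: (lower_ratio_cvg d_ge2 p01 chiP c0 c1 pc).
exact: (upper_ratio_cvg d_ge2 p01 chiP).
Unshelve. all: by end_near. Qed.
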